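(* Let $n\ge3$ and let $\mathbb T$ be a triangulation of an $n$-gon with quiddity $(c_u)_{u\in\mathbb Z}$. For all integers $i,j$ with $0\le j-i\le n+1$, $$\nu^{\mathrm{tri}}_{i,j}=\begin{cases}\ell_{i,j}&\text{if } i\le j\le i+n-2,\\ \ell_{i,i+n-1}+1=n-2&\text{if } j=i+n-1,\\ \ell_{i,i+n}+c_i+1=n-2+c_i&\text{if } j=i+n,\\ \ell_{i,i+n+1}+c_i+c_{i+1}+1=n-2+c_i+c_{i+1}&\text{if } j=i+n+1,\end{cases}$$ where $\nu^{\mathrm{tri}}_{i,j}$ is the number of occurrences of $1$ in the triangular region for $(i,j)$ of the Conway--Coxeter frieze of $\mathbb T$, and $\ell_{i,j}$ is the accumulated descendant degree.
   Context: Triangulations. Let $n\ge3$ and let $\mathcal P$ be a convex $n$-gon with vertices numbered clockwise $v_0,\dots,v_{n-1}$; indices are extended to $\mathbb Z$ by $v_{u+n}=v_u$. A triangulation $\mathbb T$ of $\mathcal P$ is by $n-3$ non-crossing diagonals; its triangles are called cells. Let $c_u$ be the number of cells having $v_u$ as a vertex; the $n$-periodic sequence $(c_u)_{u\in\mathbb Z}$ is the quiddity of $\mathbb T$. Conway--Coxeter frieze of $\mathbb T$: the array of integers $\sigma_{k,\ell}$, $0\le\ell-k\le n+1$, determined by $\sigma_{k,k}=0$, $\sigma_{k,k+1}=1$, $\sigma_{k,k+2}=c_{k+1}$ and, recursively for $\ell-k\ge3$, $\sigma_{k,\ell-1}\sigma_{k+1,\ell}-\sigma_{k+1,\ell-1}\sigma_{k,\ell}=1$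 (well defined in this range). $\nu^{\mathrm{tri}}_{k,\ell}=\#\{(a,b): k\le a,\ a+2\le b\le\ell,\ \sigma_{a,b}=1\}$. Descendant degree with respect to the base edge $v_{i-1}v_i$: for $i\le j\le i+n-1$, $\mu_{i,j}$ is the number of diagonals of $\mathbb T$ joining $v_j$ to a vertex $v_\alpha$ with $i\le\alpha\le j-2$. (Equivalently, if the cells at $v_j$ are numbered counterclockwise around $v_j$ as $\mathcal C_0,\dots,\mathcal C_{c_j-1}$ starting from the one containing the edge $v_{j-1}v_j$, then $\mathcal C_{\mu_{i,j}}$ is the one separated from the base edge by the fewest diagonals.) Moreover $\mu_{i,i+n}=\mu_{i,i}=0$ and $\mu_{i,i+n+1}=\mu_{i,i+1}=0$. Accumulated descendant degrees: $\ell_{i,i-1}=0$ and $\ell_{i,j}=\ell_{i,j-1}+\mu_{i,j}$ for $i\le j\le i+n+1$; hence $\ell_{i,i+n-1}=\ell_{i,i+n}=\ell_{i,i+n+1}$. *)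

(* Defs.v *)
From mathcomp Require Import all_boot all_order all_algebra.

Set Implicit Arguments.
Unset Strict Implicit.
Unset Printing Implicit Defensive.

Import Order.TTheory GRing.Theory Num.Theory.
Local Open Scope ring_scope.

(* The vertices of the n-gon are the residues modulo n, so that v_(u + n) = v_u *)
(* holds by construction.  'Z_n has n elements only when 1 < n; everything      *)
(* below is meant for 3 <= n.                                                   *)
Definition vertex (n : nat) (u : int) : 'Z_n := u%:~R.

Definition polygon_edge (n : nat) (x y : 'Z_n) : bool :=
  (y == x + 1) || (x == y + 1).

Definition is_diagonal (n : nat) (d : {set 'Z_n}) : bool :=
  [exists x : 'Z_n, exists y : 'Z_n,
     [&& d == [set x; y], x != y & ~~ polygon_edge x y]].

(* In a convex polygon, chords cross (in their interiors) iff their endpoints   *)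
(* are distinct and alternate around the boundary.  The order used here is that *)
(* of the representatives 0, ..., n - 1; since it fixes which chord owns the    *)
(* smallest endpoint, the relation is not symmetric in d and e.                 *)
Definition crosses (n : nat) (d e : {set 'Z_n}) : Prop :=
  exists x y z t : 'Z_n,
    [/\ (x < y < z)%N, (z < t)%N, d = [set x; z] & e = [set y; t]].

Definition is_triangulation (n : nat) (T : {set {set 'Z_n}}) : Prop :=
  [/\ forall d, d \in T -> is_diagonal d,
      forall d e, d \in T -> e \in T -> ~ crosses d e
    & #|T| = (n - 3)%N].

(* The cells of T are the triangles whose sides are edges of the polygon or     *)
(* diagonals of T.  No diagonal of T can enter the interior of such a triangle, *)
(* as it would cross one of its sides.                                          *)
Definition cells (n : nat) (T : {set {set 'Z_n}}) : {set {set 'Z_n}} :=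
  [set C : {set 'Z_n} | (#|C| == 3%N) &&
     [forall x in C, forall y in C,
        (x != y) ==> (polygon_edge x y || ([set x; y] \in T))]].

Definition quiddity (n : nat) (T : {set {set 'Z_n}}) (u : int) : nat :=
  #|[set C in cells T | vertex n u \in C]|.

(* Only the entries sigma k l with 0 <= l - k <= n + 1 are meaningful; when c   *)
(* is the quiddity of a triangulation they are determined by these conditions.  *)
Definition is_frieze (n : nat) (c : int -> nat) (sigma : int -> int -> int) :
    Prop :=
  [/\ forall k, sigma k k = 0,
      forall k, sigma k (k + 1) = 1,
      forall k, sigma k (k + 2) = (c (k + 1))%:Z
    & forall k l, 3 <= l - k <= n%:Z + 1 ->
        sigma k (l - 1) * sigma (k + 1) l - sigma (k + 1) (l - 1) * sigma k l
        = 1].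

(* Number of pairs (a, b) with k <= a, a + 2 <= b <= l and sigma a b = 1, for   *)
(* k <= l, written as a = k + p.1 and b = k + p.2 with 0 <= p.1, p.2 <= l - k.  *)
Definition nu_tri (sigma : int -> int -> int) (k l : int) : nat :=
  #|[set p : 'I_(`|l - k|%N.+1) * 'I_(`|l - k|%N.+1) |
      (p.1 + 2 <= p.2)%N && (sigma (k + p.1%:Z) (k + p.2%:Z) == 1)]|.

(* Number of diagonals of T joining v_j to some v_alpha, i <= alpha <= j - 2,   *)
(* for i <= j <= i + n - 1; here alpha = i + a.  The values at j = i + n and    *)
(* j = i + n + 1 are 0 by convention.                                           *)
Definition descendant_degree (n : nat) (T : {set {set 'Z_n}}) (i j : int) :
    nat :=
  if j <= i + n%:Z - 1 then
    #|[set d in T | [exists a : 'I_n,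
         (i + a%:Z <= j - 2) && (d == [set vertex n j; vertex n (i + a%:Z)])]]|
  else 0%N.

(* l_(i, j) = mu_(i, i) + ... + mu_(i, j), for j >= i - 1.                      *)
Definition descendant_degree_sum (n : nat) (T : {set {set 'Z_n}}) (i j : int) :
    nat :=
  (\sum_(m < `|(j - i + 1)%R|) descendant_degree T i (i + m%:Z)%R)%N.

(* Main.v *)
Require Import Defs.
From mathcomp Require Import all_boot all_order all_algebra.
From mathcomp Require Import zify ring.

Set Implicit Arguments.
Unset Strict Implicit.
Unset Printing Implicit Defensive.

Import Order.TTheory GRing.Theory Num.Theory.

(* A noncrossing set of chords on the vertices a, ..., b, the edges v_k v_(k+1) *)
(* left out, has at most b - a - 1 elements, and equality forces a cell over  *)
(* the chord ab; so n - 3 diagonals cut the polygon into cells.               *)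
(*   Let w_a in Z^2 solve w_(a-1) + w_(a+1) = c_a w_a with det(w_0, w_1) = 1. *)
(* If m is the apex of the cell over ab, the recurrence at m, together with   *)
(* the fans at a, m and b, yields the Farey rule w_m = w_a + w_b.  Hence      *)
(* det(w_a, w_b) = 1 on the sides of all cells and w_(a+n) = - w_a, while     *)
(* Ptolemy's relation gives det > 1 on every other chord.  By uniqueness the  *)
(* frieze is (det(w_k, w_l)), so its entries 1 with 2 <= l - k <= n - 1 are   *)
(* exactly the diagonals and the edges v_k v_(k+n-1).  The last two columns,  *)
(* j = i + n and j = i + n + 1, contribute the fans of v_i and v_(i+1).       *)

(** Vertices are unrolled to naturals, so that both sides of the identity become values of [ones],
    whose bound [y.-1] leaves adjacent pairs out. Accumulated degrees count diagonals of [T] inside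
    a window ([descendant_degree_sumE]), with total n - 3 ([card_diagonals]). Frieze entries are
    determinants ([frieze_det]), equal to 1 exactly on chords, edges included ([det_eq1]). The two
    counts agree until the window closes up at j = i + n - 1, where the edge v_i v_(i+n-1) adds 1
    ([ones_chord_full]). In the last two columns antiperiodicity gives entries 0 and -1 at the
    repeated vertices, and the other entries equal to 1 are chords at v_i, then at v_(i+1)
    ([column_det]). Two combinatorial facts feed this: [ones_bound] obtains the cells from the
    number of diagonals alone, and [cells_count] turns the quiddity into a count of chords. *)

Definition ones (F : nat -> nat -> bool) (a b : nat) : nat :=
  \sum_(a <= y < b.+1) \sum_(a <= x < y.-1) F x y.

Lemma big_nat_false (F : nat -> bool) a b :
  (forall x, a <= x -> x < b -> F x -> False) -> \sum_(a <= x < b) F x = 0.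
Proof.
move=> F0; rewrite big_nat big1 // => x /andP[ax xb].
by apply/eqP; rewrite eqb0; apply/negP; apply: F0.
Qed.

(** With unrolled indices, cyclic alternation of four vertices is linear order within a window of
    length [n]. *)
Definition noncrossing (n : nat) (E : rel nat) : Prop :=
  forall a b c d, a < b -> b < c -> c < d -> d < a + n -> E a c -> E b d ->
  False.

(** The binary tree of cells under the chord ab; [m] is the apex of the cell resting on ab. *)
Inductive triangulated (E : rel nat) : nat -> nat -> Prop :=
| triangulated_edge a : E a a.+1 -> triangulated E a a.+1
| triangulated_glue a m b : a < m < b -> E a b ->
    triangulated E a m -> triangulated E m b -> triangulated E a b.

Lemma triangulated_chord E a b : triangulated E a b -> E a b.
Proof. by case. Qed.

Lemma ones_split F a m b : a < m < b ->
  ones F a b = ones F a m + ones F m b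
    + \sum_(m.+1 <= y < b.+1) \sum_(a <= x < m) F x y.
Proof.
move=> /andP[am mb]; rewrite /ones (@big_cat_nat _ _ _ m.+1) /=; [|lia|lia].
rewrite -addnA; congr (_ + _).
rewrite [X in _ = X + _](@big_cat_nat _ _ _ m.+1) /=; [|lia|lia].
rewrite big_nat1 [X in X + _ + _]big_geq ?add0n; last by lia.
rewrite -big_split /=; apply: eq_big_nat => y /andP[my yb].
by rewrite (@big_cat_nat _ _ _ m) /= 1?addnC //; lia.
Qed.

(** Let m be the last neighbour of a before b. A chord straddling m either crosses am, or starts at
    a and contradicts maximality, or is ab. Hence the bound (m-a-1) + (b-m-1) + 1, and equality
    makes both parts extremal. *)
Lemma ones_bound n E a b : noncrossing n E -> (forall x, E x x.+1) ->
  a < b < a + n ->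
  ones E a b <= b - a - 1 /\ (ones E a b = b - a - 1 -> triangulated E a b).
Proof.
move=> nc Esucc; have [k] := ubnP (b - a); elim: k => // k IHk in a b *.
move=> hk /andP[ab bn].
have [->|ab2] := eqVneq b a.+1.
  split; last by move=> _; apply: triangulated_edge.
  rewrite /ones big_nat big1 // => y /andP[ay yb].
  by rewrite big_geq //; lia.
have exm : exists m, (a < m < b) && E a m.
  by exists a.+1; rewrite Esucc andbT; lia.
have ubm m : (a < m < b) && E a m -> m <= b by lia.
case: (ex_maxnP exm ubm) => m /andP[/andP[am mb] Eam] maxm.
have cross0 : \sum_(m.+1 <= y < b.+1) \sum_(a <= x < m) E x y = E a b.
  rewrite big_nat_recr /=; last by lia.
  rewrite big_nat big1 ?add0n; last first.
    move=> y /andP[my yb]; rewrite big_nat_false // => x ax xm Exy.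
    have [ax'|] := ltnP a x; first by apply: (nc a x m y) => //; lia.
    move=> xa; have xa' : x = a by lia.
    have /maxm : (a < y < b) && E a y by rewrite -xa' Exy andbT; lia.
    by lia.
  rewrite big_ltn // big_nat_false ?addn0 // => x ax xm Exy.
  by apply: (nc a x m b) => //; lia.
rewrite (@ones_split _ a m b) ?am // cross0.
have [||le1 eq1] := IHk a m; [lia|lia|].
have [||le2 eq2] := IHk m b; [lia|lia|].
case Eab: (E a b); split; try lia.
move=> h; apply: (@triangulated_glue _ a m b) => //; first by rewrite am.
  by apply: eq1; lia.
by apply: eq2; lia.
Qed.

(** A chord straddling the apex m would cross am or mb, unless it is ab itself. *)
Lemma triangulated_sub n E a b x y : noncrossing n E -> triangulated E a b ->
  b < a + n -> a <= x -> x < y -> y <= b -> E x y -> triangulated E x y.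
Proof.
move=> nc; elim=> {a b} [a Ea|a m b /andP[am mb] Eab tam IHam tmb IHmb].
  move=> _ ax xy ya Exy; have -> : x = a by lia.
  have -> : y = a.+1 by lia.
  exact: triangulated_edge.
move=> bn ax xy yb Exy.
have [ym|my] := leqP y m; first by apply: IHam => //; lia.
have [mx|xm] := leqP m x; first by apply: IHmb => //; lia.
have [ax'|xa] := ltnP a x.
  by case: (@nc a x m y) => //; [lia|apply: triangulated_chord].
have xa' : x = a by lia.
have [yb'|by_] := ltnP y b.
  case: (@nc a m y b) => //; [by rewrite -xa'|exact: triangulated_chord].
have -> : y = b by lia.
by rewrite xa'; apply: (@triangulated_glue _ a m b) => //; rewrite am.
Qed.

(** * Reindexing the counts *)

Lemma ones_recr F a b : a <= b.+1 ->
  ones F a b.+1 = ones F a b + \sum_(a <= x < b) F x b.+1.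
Proof. by move=> ab; rewrite /ones big_nat_recr. Qed.

Lemma big_nat_shift (F : nat -> nat) a k :
  \sum_(a <= x < a + k) F x = \sum_(0 <= x < k) F (a + x).
Proof.
rewrite -{1}[a]add0n big_addn addKn.
by apply: eq_bigr => x _; rewrite addnC.
Qed.

Lemma ones_shift F a k :
  ones F a (a + k) = ones (fun x y => F (a + x) (a + y)) 0 k.
Proof.
rewrite /ones -addnS big_nat_shift; apply: eq_bigr => -[|y] _.
  by rewrite !big_geq //; lia.
by rewrite addnS /= big_nat_shift.
Qed.

Lemma card_ones (F : nat -> nat -> bool) k :
  #|[set p : 'I_k.+1 * 'I_k.+1 | (p.1 + 2 <= p.2) && F p.1 p.2]| = ones F 0 k.
Proof.
rewrite -sum1dep_card big_mkcond /=.
rewrite -(pair_bigA _ (fun x y : 'I_k.+1 =>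
  if (x + 2 <= y) && F x y then 1 else 0)) /= exchange_big /ones big_mkord /=.
apply: eq_bigr => y _; have := ltn_ord y => yk.
rewrite -(big_mkord xpredT (fun x => if (x + 2 <= y) && F x y then 1 else 0)).
rewrite (@big_cat_nat _ _ _ y.-1) /=; [|lia|lia].
rewrite [X in _ + X]big_nat [X in _ + X]big1 => [|x xy]; last first.
  by rewrite (_ : x + 2 <= y = false) //; lia.
rewrite addn0; apply: eq_big_nat => x xy.
by rewrite (_ : x + 2 <= y) /=; [case: (F _ _)|lia].
Qed.

Local Open Scope ring_scope.

(** * The recurrence of the quiddity and the Farey rule *)

Definition recurrence (c : nat -> nat) (f : nat -> int) : Prop :=
  forall m, f m + f m.+2 = f m.+1 *+ c m.+1.

(** A vertex of c cells carries c + 1 chords, its two edges included. *)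
Definition degrees (n : nat) (E : rel nat) (c : nat -> nat) : Prop :=
  forall m, (c m).+1 = (\sum_(m.+1 <= x < m + n) E m x)%N.

Definition wraps (n : nat) (E : rel nat) : Prop :=
  forall x m, E m (x + n)%N = E x m.

(** Once around from m: the neighbours before b, then b, none between b and a + n (they would cross
    ab), then a + n, then the neighbours between a and m. *)
Lemma apex_degree n E c a m b : noncrossing n E -> degrees n E c ->
  wraps n E -> (a < m < b)%N -> (b < a + n)%N -> E a b -> E a m -> E m b ->
  c m = (\sum_(a.+1 <= x < m) E x m + \sum_(m.+1 <= x < b) E m x + 1)%N.
Proof.
move=> nc dg wr /andP[am mb] ban Eab Eam Emb; apply: succn_inj.
rewrite dg (@big_cat_nat _ _ _ b) /=; [|lia|lia].
rewrite (@big_ltn _ _ _ b) ?Emb /=; last by lia.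
rewrite (@big_cat_nat _ _ _ (a + n) b.+1) /=; [|lia|lia].
rewrite (@big_nat_false _ b.+1) => [|x bx xa Emx]; last first.
  by apply: (nc a m b x) => //; lia.
rewrite (@big_ltn _ _ _ (a + n)%N) ?ltn_add2r // wr Eam -addSn big_addn addnK.
rewrite [X in (_ + (_ + (_ + (_ + X))))%N](eq_bigr (fun x => E x m : nat));
  last by move=> x _; rewrite wr.
by move: (\sum_(_ <= i < m) _)%N => u; lia.
Qed.

(** With u and v the two fan sizes at m, the recurrence reads f(m-1) + f(m+1) = (u + v + 1) f(m);
    the last two hypotheses cancel u and v. *)
Lemma apex_sum n E c f a m b : noncrossing n E -> degrees n E c ->
  wraps n E -> recurrence c f -> (a < m < b)%N -> (b < a + n)%N -> E a b ->
  E a m -> E m b ->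
  f m.-1 = f a + f m *+ (\sum_(a.+1 <= x < m) E x m) ->
  f m.+1 = f m *+ (\sum_(m.+1 <= x < b) E m x) + f b -> f m = f a + f b.
Proof.
move=> nc dg wr rec amb ban Eab Eam Emb fpred fsucc.
have /andP[am mb] := amb.
have := rec m.-1; rewrite (@ltn_predK a m) // fpred fsucc.
rewrite (apex_degree nc dg wr amb ban Eab Eam Emb) !mulrnDr mulr1n.
by set u := _ *+ _; set v := _ *+ _; lia.
Qed.

(** A chord from a to a vertex between m and b would cross mb, so passing from am to ab adds just am
    to the fan at a; the Farey rule absorbs the extra f(a). The end b is symmetric. *)
Lemma fan n E c f a b : noncrossing n E -> degrees n E c -> wraps n E ->
  recurrence c f -> triangulated E a b -> (b < a + n)%N ->
  f a.+1 = f a *+ (\sum_(a.+1 <= x < b) E a x) + f b /\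
  f b.-1 = f a + f b *+ (\sum_(a.+1 <= x < b) E x b).
Proof.
move=> nc dg wr rec; elim=> {a b} [a _ _|a m b amb Eab tam IHam tmb IHmb ban].
  by rewrite !big_geq // !mulr0n add0r addr0.
have /andP[am mb] := amb.
have [|IHa1 IHa2] := IHam _; first by lia.
have [|IHb1 IHb2] := IHmb _; first by lia.
have Eam := triangulated_chord tam; have Emb := triangulated_chord tmb.
have sumab := apex_sum nc dg wr rec amb ban Eab Eam Emb IHa2 IHb1.
split.
  rewrite IHa1 sumab (@big_cat_nat _ _ _ m a.+1 b) /=; [|lia|lia].
  rewrite (@big_ltn _ _ _ m b) // Eam (@big_nat_false _ m.+1).
    by rewrite mulrnDr addn0 mulr1n addrA.
  by move=> x mx xb Eax; apply: (nc a m x b) => //; lia.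
rewrite IHb2 sumab (@big_cat_nat _ _ _ m a.+1 b) /=; [|lia|lia].
rewrite (@big_ltn _ _ _ m b) // Emb (@big_nat_false _ a.+1 m).
  by rewrite add0n mulrnDr mulr1n -addrA.
by move=> x ax xm Exb; apply: (nc a x m b) => //; lia.
Qed.

Fixpoint linrec (c : nat -> nat) (u v : int) (m : nat) : int :=
  if m is m1.+1 then
    if m1 is m2.+1 then linrec c u v m1 *+ c m1 - linrec c u v m2 else v
  else u.

Lemma linrec_recurrence c u v : recurrence c (linrec c u v).
Proof. by move=> m; rewrite addrC [linrec c u v m.+2]/= subrK. Qed.

Definition det (f g : nat -> int) (k l : nat) : int := f k * g l - g k * f l.

(** The transfer matrix of the recurrence has determinant 1, so the discrete Wronskian is
    constant. *)
Lemma det_succ c f g m : recurrence c f -> recurrence c g ->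
  det f g 0 1 = 1 -> det f g m m.+1 = 1.
Proof.
move=> recf recg; elim: m => // m IHm /IHm <-; rewrite /det.
have step h : recurrence c h -> h m.+2 = h m.+1 * (c m.+1)%:R - h m.
  by move=> /(_ m); rewrite mulr_natr; lia.
by rewrite !step //; ring.
Qed.

Lemma det_self f g a : det f g a a = 0.
Proof. by rewrite /det mulrC subrr. Qed.

(** * The frieze as an array of determinants *)

Section Frieze.
Variables (n : nat) (E : rel nat) (c : nat -> nat).
Hypotheses (n_ge3 : (3 <= n)%N) (nc : noncrossing n E) (dg : degrees n E c).
Hypotheses (wr : wraps n E).
Hypothesis full : forall a, triangulated E a (a + n.-1).

Lemma corner_degree a : c a = (\sum_(a.+1 <= x < a + n.-1) E a x)%N.
Proof.
apply: succn_inj; rewrite dg.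
have -> : (a + n = (a + n.-1).+1)%N by lia.
rewrite big_nat_recr /=; last by lia.
by rewrite (triangulated_chord (full a)) addn1.
Qed.

Lemma corner_degree_wrap a :
  c (a + n.-1) = (\sum_(a.+1 <= x < a + n.-1) E x (a + n.-1))%N.
Proof.
apply: succn_inj; rewrite dg.
have -> : ((a + n.-1).+1 = a + n)%N by lia.
rewrite big_ltn; last by lia.
rewrite wr (triangulated_chord (full a)) add1n -addSn big_addn addnK.
by congr _.+1; apply: eq_bigr => x _; rewrite wr.
Qed.

(** In the whole polygon the fan at a + n - 1 has size c(a+n-1); comparing it with the recurrence
    there leaves h(a) = - h(a+n). *)
Lemma antiperiodic h a : recurrence c h -> h (a + n)%N = - h a.
Proof.
move=> rech; have an : (a + n.-1 < a + n)%N by lia.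
have [_] := fan nc dg wr rech (full a) an.
rewrite -corner_degree_wrap.
have := rech (a + n.-2)%N.
have -> : ((a + n.-2).+2 = a + n)%N by lia.
have -> : ((a + n.-2).+1 = a + n.-1)%N by lia.
have -> : ((a + n.-1).-1 = a + n.-2)%N by lia.
by set u := _ *+ _; lia.
Qed.

Variables f g : nat -> int.
Hypotheses (recf : recurrence c f) (recg : recurrence c g).

Lemma det_antiperiodic a b : det f g a (b + n) = - det f g a b.
Proof. by rewrite /det !antiperiodic //; ring. Qed.

Hypothesis det01 : det f g 0 1 = 1.

(** By [fan], w_(a+1) and w_b differ by a multiple of w_a. *)
Lemma det_triangulated a b : triangulated E a b -> (b < a + n)%N ->
  det f g a b = 1.
Proof.
move=> tab ban; have [fa _] := fan nc dg wr recf tab ban.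
have [ga _] := fan nc dg wr recg tab ban.
have := det_succ a recf recg det01; rewrite /det fa ga.
rewrite -[f a *+ _]mulr_natr -[g a *+ _]mulr_natr.
by set u := _%:R; move: u => u; move=> <-; ring.
Qed.

Lemma det_chord a b : (a < b < a + n)%N -> E a b -> det f g a b = 1.
Proof.
move=> /andP[ab ban] Eab; apply: det_triangulated => //.
by apply: (triangulated_sub nc (full a)) => //; lia.
Qed.

(** Only chords straddling the apex m matter. From k = a, the Farey rule gives det(w_m, w_l) +
    det(w_l, w_b), at least 2 unless l = b; otherwise Ptolemy gives a sum of two positive
    products. *)
Lemma det_triangulated_ge1 a b k l : triangulated E a b -> (b < a + n)%N ->
  (a <= k)%N -> (k < l)%N -> (l <= b)%N ->
  1 <= det f g k l /\ (det f g k l = 1 -> E k l).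
Proof.
move=> tab; elim: tab k l => {a b} [a Ea k l|a m b amb Eab tam IHam tmb IHmb].
  move=> ban ak kl la; have -> : k = a by lia.
  have -> : l = a.+1 by lia.
  by rewrite (det_succ a recf recg).
move=> k l ban ak kl lb; have /andP[am mb] := amb.
have [lm|ml] := leqP l m; first by apply: IHam => //; lia.
have [mk|km] := leqP m k; first by apply: IHmb => //; lia.
have Eam := triangulated_chord tam; have Emb := triangulated_chord tmb.
have amn : (m < a + n)%N by lia.
have mbn : (b < m + n)%N by lia.
have apexf : f m = f a + f b.
  apply: (apex_sum nc dg wr recf amb ban Eab Eam Emb).
    by have [] := fan nc dg wr recf tam amn.
  by have [] := fan nc dg wr recf tmb mbn.
have apexg : g m = g a + g b.
  apply: (apex_sum nc dg wr recg amb ban Eab Eam Emb).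
    by have [] := fan nc dg wr recg tam amn.
  by have [] := fan nc dg wr recg tmb mbn.
have detam := det_triangulated tam amn.
have [detkm _] : 1 <= det f g k m /\ (det f g k m = 1 -> E k m).
  by apply: IHam => //; lia.
have [detml _] : 1 <= det f g m l /\ (det f g m l = 1 -> E m l).
  by apply: IHmb => //; lia.
have detal : det f g a l = det f g m l + det f g l b.
  by rewrite /det apexf apexg; ring.
have detlb : l = b \/ 1 <= det f g l b.
  have [->|lb'] := eqVneq l b; first by left.
  by right; apply: (IHmb l b _ _ _ _).1 => //; lia.
have detlb0 : 0 <= det f g l b.
  by case: detlb => [->|]; [rewrite /det|]; lia.
have [ak'|ka] := ltnP a k; last first.
  have -> : k = a by lia.
  rewrite detal; split; first by lia.
  by case: detlb => [-> //|]; lia.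
have [detak _] : 1 <= det f g a k /\ (det f g a k = 1 -> E a k).
  by apply: IHam => //; lia.
(* Ptolemy's relation for the quadrilateral a, k, m, l, with a m of length 1 *)
have ptolemy : det f g k l
    = det f g a k * det f g m l + det f g a l * det f g k m.
  by rewrite -[LHS]mul1r -detam /det; ring.
by rewrite ptolemy; split; nia.
Qed.

Lemma det_ge1 a b : (a < b < a + n)%N -> 1 <= det f g a b.
Proof.
move=> /andP[ab ban].
by apply: (det_triangulated_ge1 (full a) _ _ _ _).1 => //; lia.
Qed.

Lemma det_eq1 a b : (a < b < a + n)%N -> (det f g a b == 1) = E a b.
Proof.
move=> abn; have /andP[ab ban] := abn.
apply/eqP/idP; last exact: det_chord.
by apply: (det_triangulated_ge1 (full a) _ _ _ _).2 => //; lia.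
Qed.

Local Notation det1 a b := (det f g a b == 1).

Lemma ones_det a b : (b < a + n)%N ->
  ones (fun x y => det1 x y) a b = ones E a b.
Proof.
move=> ban; apply: eq_big_nat => y yb; apply: eq_big_nat => x xy.
by rewrite det_eq1 //; lia.
Qed.

Lemma column_det a :
  (\sum_(a.+1 <= x < a + n.-1) det1 x (a + n)%N = c a)%N.
Proof.
rewrite corner_degree; apply: eq_big_nat => x xa.
by rewrite det_eq1 ?wr //; lia.
Qed.

Lemma ones_det_n a :
  ones (fun x y => det1 x y) a (a + n) = (ones E a (a + n.-1) + c a)%N.
Proof.
have -> : (a + n = (a + n.-1).+1)%N by lia.
rewrite ones_recr; last by lia.
rewrite ones_det; last by lia.
have -> : ((a + n.-1).+1 = a + n)%N by lia.
rewrite big_ltn; last by lia.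
(* The entry at [x = a] is - det(w_a, w_a) = 0, hence not counted. *)
by rewrite det_antiperiodic det_self column_det.
Qed.

Lemma ones_det_n1 a : ones (fun x y => det1 x y) a (a + n).+1
  = (ones E a (a + n.-1) + c a + c a.+1)%N.
Proof.
rewrite ones_recr; last by lia.
rewrite ones_det_n -addSn big_ltn; last by lia.
rewrite big_ltn; last by lia.
(* The entries at [a] and [a.+1] are -1 and 0; what remains is the column of [a.+1]. *)
rewrite !det_antiperiodic det_self (det_succ a recf recg det01).
rewrite -(column_det a.+1).
by have -> : (a.+1 + n.-1 = a + n)%N by lia.
Qed.

(** Determinants satisfy the frieze rule by a Plücker relation, and the coefficient det(w_(k+1),
    w_(l-1)) of the new entry stays positive up to l - k = n + 1, so the entry is forced. *)
Lemma frieze_det (q : int -> nat) sigma i s : is_frieze n q sigma ->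
  (forall x : nat, q (i + x%:Z) = c (s + x)) ->
  forall x y : nat, (x <= y <= x + n.+1)%N ->
  sigma (i + x%:Z) (i + y%:Z) = det f g (s + x) (s + y).
Proof.
move=> [s0 s1 s2 s3] qc x y; have [k] := ubnP (y - x)%N.
elim: k => // k IHk in x y *; move=> hk /andP[xy yn].
have succ z : i + z.+1%:Z = i + z%:Z + 1 by lia.
have step h z : recurrence c h -> h z.+2 = h z.+1 * (c z.+1)%:R - h z.
  by move=> /(_ z); rewrite mulr_natr; lia.
have [->|nxy0] := eqVneq y x; first by rewrite s0 det_self.
have [->|nxy1] := eqVneq y x.+1.
  by rewrite succ s1 addnS (det_succ _ recf recg det01).
have [->|nxy2] := eqVneq y x.+2.
  rewrite !succ -addrA s2 -succ qc !addnS.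
  rewrite -[LHS]mul1r -(det_succ (s + x) recf recg det01) /det !step //.
  by rewrite natz; ring.
have h3 : 3 <= (i + y%:Z) - (i + x%:Z) <= n%:Z + 1 by lia.
have := s3 _ _ h3.
have -> : i + y%:Z - 1 = i + y.-1%:Z by rewrite -subn1; lia.
rewrite -succ (IHk x y.-1) ?(IHk x.+1 y) ?(IHk x.+1 y.-1); [|lia..].
have pos : 1 <= det f g (s + x.+1) (s + y.-1) by apply: det_ge1; lia.
set t := sigma _ _ => ht.
have plucker : det f g (s + x) (s + y.-1) * det f g (s + x.+1) (s + y)
  - det f g (s + x.+1) (s + y.-1) * det f g (s + x) (s + y) = 1.
  rewrite -[RHS]mulr1 -{1}(det_succ (s + x) recf recg det01).
  rewrite -(det_succ (s + y.-1) recf recg det01).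
  have -> : ((s + y.-1).+1 = s + y)%N by lia.
  by rewrite addnS /det; ring.
apply: (@mulfI _ (det f g (s + x.+1) (s + y.-1))); first by lia.
by lia.
Qed.

End Frieze.
Local Close Scope ring_scope.

(** * Diagonals of the polygon as a noncrossing relation on naturals *)

Section Polygon.
Variables (n : nat) (T : {set {set 'Z_n}}).
Hypotheses (n_ge3 : 3 <= n) (triT : is_triangulation T).
Implicit Types a b m : nat.

Local Notation "a %:v" := (a%:R%R : 'Z_n) (at level 2, format "a %:v").

Definition side (x y : 'Z_n) : bool := polygon_edge x y || ([set x; y] \in T).

Definition chord (a b : nat) : bool := side a%:v b%:v.

Lemma side_sym (x y : 'Z_n) : side x y = side y x.
Proof. by rewrite /side setUC; congr orb; apply: orbC. Qed.

Lemma natZ_eq a b : (a%:v == b%:v) = (a == b %[mod n]).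
Proof. by rewrite -val_eqE /= !val_Zp_nat //; lia. Qed.

Lemma natZ_wrap a : (a + n)%:v = a%:v.
Proof. by apply/eqP; rewrite natZ_eq modnDr. Qed.

Lemma natZ_neq a b : a < b < a + n -> (a%:v == b%:v) = false.
Proof.
move=> abn; rewrite natZ_eq eq_sym eqn_mod_dvd; last by lia.
by apply: contraTF abn => /dvdnP[[|k] hk]; lia.
Qed.

Lemma natZ_inj k a b : k <= a < k + n -> k <= b < k + n -> a%:v = b%:v -> a = b.
Proof.
move=> ha hb; wlog ab : a b ha hb / a < b => [W|].
  by case: (ltngtP a b) => // ? /esym; [move/esym|]; move/W => ->.
by move=> /eqP; rewrite natZ_neq //; lia.
Qed.

Lemma natZ_offset m (x : 'Z_n) : exists2 a, a < n & x = (m + a)%:v.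
Proof.
have n1 : 1 < n by lia.
exists (val (x - m%:v)%R).
  by have := ltn_ord (x - m%:v)%R; rewrite [X in _ < X](Zp_cast n1).
by rewrite natrD natr_Zp addrC subrK.
Qed.

Lemma chord_sym a b : chord a b = chord b a.
Proof. exact: side_sym. Qed.

Lemma chord_succ a : chord a a.+1.
Proof. by rewrite /chord /side /polygon_edge -natr1 eqxx. Qed.

Lemma chord_wrap : wraps n chord.
Proof. by move=> x m; rewrite /chord natZ_wrap side_sym. Qed.

Lemma edgeE a b : a < b < a + n ->
  polygon_edge a%:v b%:v = (b == a.+1) || (b == a + n.-1).
Proof.
move=> abn; rewrite /polygon_edge !natr1; congr orb.
  apply/eqP/eqP => [|-> //]; apply: (@natZ_inj a.+1); lia.
apply/eqP/eqP => [|->]; last first.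
  by rewrite (_ : (a + n.-1).+1 = a + n) ?natZ_wrap //; lia.
by rewrite -natZ_wrap => /(@natZ_inj b.+1) h; lia.
Qed.

Lemma diagonal_not_edge (x y : 'Z_n) :
  [set x; y] \in T -> polygon_edge x y = false.
Proof.
have [diag _ _] := triT => /diag /existsP[z /existsP[t /and3P[/eqP e zt]]].
apply: contraNF => xy.
have : z \in [set x; y] by rewrite e !inE eqxx.
have : t \in [set x; y] by rewrite e !inE eqxx orbT.
rewrite !inE => /orP[]/eqP ht /orP[]/eqP hz; move: zt; rewrite ht hz ?eqxx //.
by move: xy; rewrite /polygon_edge orbC.
Qed.

Lemma chordE a b : a.+1 < b < a + n.-1 ->
  chord a b = ([set a%:v; b%:v] \in T).
Proof. by move=> abn; rewrite /chord /side edgeE; lia. Qed.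

Lemma diagonal_bounds a b : a < b < a + n -> [set a%:v; b%:v] \in T ->
  a.+1 < b < a + n.-1.
Proof. by move=> abn /diagonal_not_edge; rewrite edgeE //; lia. Qed.

Lemma natZ_crosses a b c d : a < b -> b < c -> c < d -> d < n ->
  crosses [set a%:v; c%:v] [set b%:v; d%:v].
Proof.
move=> ab bc cd dn; exists a%:v, b%:v, c%:v, d%:v.
by split=> //; rewrite /= !val_Zp_nat ?modn_small //; lia.
Qed.

(** Once a < n, the cases are how many of d, c, b pass n. Each wrap changes which vertex has the
    smallest representative, hence the order in which the chords enter [crosses]. *)
Lemma chord_noncrossing : noncrossing n chord.
Proof.
move=> a b c d ab bc cd da; rewrite !chordE; [|lia|lia].
have [_ nocross _] := triT.
wlog an : a b c d ab bc cd da / a < n => [W|].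
  have shift k : a %/ n * n <= k -> k%:v = (k - a %/ n * n)%:v.
    move=> ak; apply/eqP; rewrite natZ_eq.
    by rewrite -[in X in X == _](subnK ak) addnC modnMDl.
  have := leq_divM a n; have := ltn_mod a n; have := divn_eq a n => eqa lta lea.
  rewrite (shift a) ?(shift b) ?(shift c) ?(shift d); [|lia..].
  by apply: W; lia.
have [dn|nd] := ltnP d n.
  by move=> dac dbd; apply: (nocross _ _ dac dbd); apply: natZ_crosses.
have wrap k : n <= k -> k%:v = (k - n)%:v.
  by move=> /subnK {1}<-; apply: natZ_wrap.
rewrite (wrap d) // [X in X \in T -> False]setUC => dac ddb.
have [cn|nc] := ltnP c n.
  by apply: (nocross _ _ ddb dac); apply: natZ_crosses; lia.
move: dac; rewrite (wrap c) // setUC => dca.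
have [bn|nb] := ltnP b n.
  by apply: (nocross _ _ dca ddb); apply: natZ_crosses; lia.
move: ddb; rewrite (wrap b) // setUC => dbd.
by apply: (nocross _ _ dbd dca); apply: natZ_crosses; lia.
Qed.

Lemma natZ_pair_inj s a b c d : a < b < n -> c < d < n ->
  [set (s + a)%:v; (s + b)%:v] = [set (s + c)%:v; (s + d)%:v] ->
  a = c /\ b = d.
Proof.
move=> abn cdn e.
have inj k l : (s + k)%:v = (s + l)%:v -> k < n -> l < n -> k = l.
  by move=> /(@natZ_inj s) h *; lia.
have : (s + a)%:v \in [set (s + c)%:v; (s + d)%:v] by rewrite -e !inE eqxx.
have : (s + b)%:v \in [set (s + c)%:v; (s + d)%:v].
  by rewrite -e !inE eqxx orbT.
by rewrite !inE => /orP[]/eqP/inj hb /orP[]/eqP/inj ha; lia.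
Qed.

Lemma card_diagonals s :
  ones (fun x y => [set (s + x)%:v; (s + y)%:v] \in T) 0 n.-1 = n - 3.
Proof.
have [diag _ <-] := triT; rewrite -card_ones.
pose f (p : 'I_n.-1.+1 * 'I_n.-1.+1) := [set (s + p.1)%:v; (s + p.2)%:v].
rewrite -(@card_in_imset _ _ f) => [|[a b] [c d]]; last first.
  rewrite !inE /= => /andP[ab _] /andP[cd _] /natZ_pair_inj.
  have := ltn_ord b; have := ltn_ord d => dn bn.
  by case=> [||ac bd] /=; [lia|lia|]; congr pair; apply: val_inj.
congr #|pred_of_set _|; apply/setP => e; apply/imsetP/idP.
  by move=> [p]; rewrite inE => /andP[_ pT] ->.
move=> eT; have /existsP[x /existsP[y]] := diag _ eT.
have [a an ->] := natZ_offset s x; have [b bn ->] := natZ_offset s y.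
wlog ab : a b an bn / a < b => [W|].
  case: (ltngtP a b) => [|ba|->]; first exact: W; last by rewrite eqxx andbF.
  move=> /and3P[/eqP h1 h2 h3]; apply: (W b a) => //.
  by rewrite setUC -h1 eqxx eq_sym h2 /= /polygon_edge orbC.
move=> /and3P[/eqP h _ _]; rewrite h in eT *.
have /andP[ab' _] : (s + a).+1 < s + b < s + a + n.-1.
  by apply: diagonal_bounds eT; lia.
have an' : a < n.-1.+1 by lia.
have bn' : b < n.-1.+1 by lia.
exists (Ordinal an', Ordinal bn') => //=.
by rewrite inE /= eT andbT; lia.
Qed.

Lemma ones_chord_sub s k : k < n.-1 ->
  ones chord s (s + k)
  = ones (fun x y => [set (s + x)%:v; (s + y)%:v] \in T) 0 k.
Proof.
move=> kn; rewrite ones_shift; apply: eq_big_nat => y yk.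
by apply: eq_big_nat => x xy; rewrite chordE //; lia.
Qed.

Lemma ones_chord_full s : ones chord s (s + n.-1) = n - 2.
Proof.
have -> : n - 2 = (n - 3).+1 by lia.
rewrite -(card_diagonals s) ones_shift.
rewrite /ones !(big_nat_recr n.-1) //= -addnS; congr addn.
  apply: eq_big_nat => y yk.
  by apply: eq_big_nat => x xy; rewrite chordE //; lia.
rewrite !(@big_ltn _ _ _ 0); [|lia|lia].
have -> : chord (s + 0) (s + n.-1) = true.
  by rewrite /chord /side edgeE ?addn0 ?eqxx ?orbT //; lia.
have -> : ([set (s + 0)%:v; (s + n.-1)%:v] \in T) = false.
  by apply/negbTE/negP => /diagonal_bounds; lia.
rewrite add0n add1n; congr _.+1.
by apply: eq_big_nat => x xy; rewrite chordE //; lia.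
Qed.

(** The count n - 2 is the extremal value in [ones_bound]. *)
Lemma chord_full s : triangulated chord s (s + n.-1).
Proof.
have sn : s < s + n.-1 < s + n by lia.
have [_] := ones_bound chord_noncrossing chord_succ sn.
by apply; rewrite ones_chord_full; lia.
Qed.

(** * Cells at a vertex and the quiddity *)

Lemma cell_apex m y : 1 < y < n -> chord m (m + y) ->
  exists2 x, 0 < x < y & chord m (m + x) && chord (m + x) (m + y).
Proof.
move=> yn my; have : triangulated chord m (m + y).
  by apply: (triangulated_sub chord_noncrossing (chord_full m)) => //; lia.
move e1: {1 3}m => k; move e2: (m + y) => l t.
case: t e1 e2 => {k l} [a _|a x b axb _ tax txb] ->; first by lia.
move=> eb; exists (x - a); first by lia.
rewrite (_ : a + (x - a) = x); last by lia.
by rewrite !triangulated_chord.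
Qed.

Lemma cell_set m x y : 0 < x < y -> y < n ->
  ([set m%:v; (m + x)%:v; (m + y)%:v] \in cells T)
  = [&& chord m (m + x), chord (m + x) (m + y) & chord m (m + y)].
Proof.
move=> xy yn; have mx : (m%:v == (m + x)%:v) = false by apply: natZ_neq; lia.
have my : (m%:v == (m + y)%:v) = false by apply: natZ_neq; lia.
have xy' : ((m + x)%:v == (m + y)%:v) = false by apply: natZ_neq; lia.
rewrite inE.
have -> : #|[set m%:v; (m + x)%:v; (m + y)%:v]| == 3.
  by rewrite setUC cardsU1 !inE ![(m + y)%:v == _]eq_sym my xy' cards2 mx.
rewrite /=; apply/forall_inP/and3P => [C|[mxE xyE myE] z zC].
  have {}C z t : z \in [set m%:v; (m + x)%:v; (m + y)%:v] ->
      t \in [set m%:v; (m + x)%:v; (m + y)%:v] -> z != t -> side z t.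
    by move=> /C/forall_inP/[apply]/implyP.
  by split; apply: C; rewrite ?inE ?eqxx ?orbT ?mx ?my ?xy'.
apply/forall_inP => t tC; apply/implyP; rewrite -/(side z t).
move: zC tC; rewrite !inE -!orbA.
case/or3P=> /eqP-> /or3P[]/eqP->; rewrite ?eqxx // => _ //.
all: by rewrite -/(chord _ _) chord_sym.
Qed.

Lemma cell_pair (C : {set 'Z_n}) m : C \in cells T -> m%:v \in C ->
  exists x y, [/\ 0 < x < y, y < n & C = [set m%:v; (m + x)%:v; (m + y)%:v]].
Proof.
rewrite inE => /andP[/eqP C3 _] mC.
have /cards2P[z [t [zt Cm]]] : #|C :\ m%:v| == 2.
  by move: C3; rewrite (cardsD1 m%:v) mC add1n => -[->].
have [zm tm] : z != m%:v /\ t != m%:v.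
  have : z \in C :\ m%:v by rewrite Cm !inE eqxx.
  have : t \in C :\ m%:v by rewrite Cm !inE eqxx orbT.
  by rewrite !inE => /andP[? _] /andP[].
have {C3}CE : C = [set m%:v; z; t] by rewrite -(setD1K mC) Cm setUA.
have [x xn ez] := natZ_offset m z; have [y yn et] := natZ_offset m t.
rewrite {z}ez {t}et in zt zm tm Cm CE *.
have x0 : x != 0 by apply: contraNneq zm => ->; rewrite addn0.
have y0 : y != 0 by apply: contraNneq tm => ->; rewrite addn0.
case: (ltngtP x y) => xy; last by rewrite xy eqxx in zt.
  by exists x, y; split=> //; lia.
by exists y, x; split=> //; [lia|rewrite CE setUAC].
Qed.

(** A cell at v_m corresponds to its last vertex m + y counted from m; noncrossing makes the middle
    vertex unique. *)
Lemma cells_count m :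
  #|[set C in cells T | m%:v \in C]| = \sum_(m.+2 <= x < m + n) chord m x.
Proof.
pose Y := [set y : 'I_n | (1 < y) && chord m (m + y)].
(* The default [y] never occurs on [Y], by [cell_apex]. *)
pose apex (y : 'I_n) : nat :=
  odflt y [pick x : 'I_n | (0 < x < y)
                           && (chord m (m + x) && chord (m + x) (m + y))].
have apexP (y : 'I_n) : y \in Y ->
    0 < apex y < y /\ chord m (m + apex y) && chord (m + apex y) (m + y).
  rewrite inE => /andP[y1 my]; rewrite /apex; case: pickP => [x /andP[]//|no].
  have yn : 1 < y < n by rewrite y1 /=.
  have [x xy mx] := cell_apex yn my.
  have xn : x < n by have := ltn_ord y; lia.
  by have := no (Ordinal xn); rewrite /= mx xy.
pose g (y : 'I_n) := [set m%:v; (m + apex y)%:v; (m + y)%:v].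
have gE : [set C in cells T | m%:v \in C] = [set g y | y in Y].
  apply/setP => C; rewrite inE; apply/andP/imsetP => [[CT mC]|[y yY ->]].
    have [x [y [xy yn CE]]] := cell_pair CT mC.
    move: CT; rewrite CE cell_set // => /and3P[mx xmy my].
    have yY : Ordinal yn \in Y by rewrite inE /= my; lia.
    exists (Ordinal yn) => //; rewrite /g /=.
    have [] := apexP _ yY; set z := apex _ => /= zy /andP[mz zmy].
    suff -> : x = z by [].
    case: (ltngtP x z) => // xz.
      by case: (@chord_noncrossing m (m + x) (m + z) (m + y)) => //; lia.
    by case: (@chord_noncrossing m (m + z) (m + x) (m + y)) => //; lia.
  have [zy /andP[mz zmy]] := apexP _ yY.
  move: yY; rewrite inE => /andP[_ my].
  by rewrite /g cell_set // mz zmy my !inE eqxx.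
rewrite gE card_in_imset => [|y y' yY yY' /setP gyy].
  rewrite -sum1dep_card big_mkcond /=.
  rewrite -(big_mkord xpredT
    (fun y => if (1 < y) && chord m (m + y) then 1 else 0)).
  rewrite (@big_cat_nat _ _ _ 2 0 n) /=; [|lia|lia].
  rewrite [X in X + _]big_nat [X in X + _]big1 => [|x x2]; last first.
    by rewrite (_ : 1 < x = false) //; lia.
  rewrite add0n -[m.+2]/(2 + m) [m + n]addnC big_addn addnK.
  apply: eq_big_nat => x /andP[x1 _].
  by rewrite x1 addnC /=; case: (chord _ _).
wlog lt_yy : y y' yY yY' gyy / y < y' => [W|].
  case: (ltngtP y y') => [|lt_yy|/val_inj//]; first exact: W.
  by apply/esym/W => // C; rewrite gyy.
(* The vertex m + y' lies beyond every vertex of [g y]. *)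
have [zy _] := apexP _ yY; have y'n := ltn_ord y'.
have := gyy (m + y')%:v; rewrite !inE eqxx orbT -orbA => /or3P[]/eqP h.
- by have := @natZ_neq m (m + y'); rewrite h eqxx => /(_ _)/negP; lia.
- by have := @natZ_neq (m + apex y) (m + y'); rewrite h eqxx; lia.
- by have := @natZ_neq (m + y) (m + y'); rewrite h eqxx; lia.
Qed.

Lemma quiddity_degrees : degrees n chord (fun m => quiddity T m%:Z).
Proof.
move=> m; rewrite big_ltn; last by lia.
by rewrite chord_succ add1n -cells_count.
Qed.

End Polygon.

Local Open Scope ring_scope.

(** * Descendant degrees and frieze counts from a base vertex *)

Section BaseVertex.
Variables (n : nat) (T : {set {set 'Z_n}}).
Hypotheses (n_ge3 : (3 <= n)%N) (triT : is_triangulation T).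

Local Notation "a %:v" := (a%:R%R : 'Z_n) (at level 2, format "a %:v").

Variables (i : int) (s : nat).
Hypothesis is_ : vertex n i = s%:v.

Lemma vertex_shift x : vertex n (i + x%:Z) = (s + x)%:v.
Proof. by rewrite /vertex intrD -/(vertex n i) is_ -pmulrn natrD. Qed.

Lemma quiddity_shift x : quiddity T (i + x%:Z) = quiddity T (s + x)%N%:Z.
Proof. by rewrite /quiddity vertex_shift /vertex -pmulrn. Qed.

Lemma descendant_degreeE m : (m < n)%N -> descendant_degree T i (i + m%:Z)
  = (\sum_(0 <= x < m.-1) ([set (s + x)%:v; (s + m)%:v] \in T))%N.
Proof.
move=> mn; rewrite /descendant_degree ifT; last by lia.
pose f (a : 'I_n) := [set (s + a)%:v; (s + m)%:v].
transitivity #|[set f a | a in [set a : 'I_n | (a < m.-1)%N && (f a \in T)]]|.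
  congr #|pred_of_set _|; apply/setP => d; rewrite inE.
  apply/andP/imsetP => [[dT /existsP[a /andP[am /eqP de]]]|[a]].
    exists a; last by rewrite de !vertex_shift setUC.
    by move: dT; rewrite inE /f de !vertex_shift setUC => ->; lia.
  rewrite inE => /andP[am fT] ->; split=> //; apply/existsP; exists a.
  by rewrite !vertex_shift setUC eqxx andbT; lia.
rewrite card_in_imset => [|a b]; last first.
  rewrite !inE => /andP[am _] /andP[bm _] /(natZ_pair_inj n_ge3) ab.
  by apply/val_inj; have [||//] := ab; lia.
rewrite -sum1dep_card big_mkcond /=.
rewrite -(big_mkord xpredT (fun a => if (a < m.-1)%N &&
  ([set (s + a)%:v; (s + m)%:v] \in T) then 1 else 0)%N).
rewrite (@big_cat_nat _ _ _ m.-1 0 n) /=; [|lia|lia].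
rewrite [X in (_ + X)%N]big_nat [X in (_ + X)%N]big1 => [|x xm]; last first.
  by rewrite (_ : (x < m.-1)%N = false) //; lia.
rewrite addn0; apply: eq_big_nat => x /andP[_ xm].
by rewrite xm /=; case: (_ \in T).
Qed.

Lemma descendant_degree_sumE d : (d < n)%N ->
  descendant_degree_sum T i (i + d%:Z)
  = ones (fun x y => [set (s + x)%:v; (s + y)%:v] \in T) 0 d.
Proof.
move=> dn; rewrite /descendant_degree_sum /ones.
rewrite (_ : absz _ = d.+1); last by lia.
rewrite big_mkord; apply: eq_bigr => m _.
by rewrite descendant_degreeE //; have := ltn_ord m; lia.
Qed.

(** At v_(i+n-1) every diagonal has been counted; later degrees are 0 by convention. *)
Lemma descendant_degree_sum_full d : (n.-1 <= d)%N ->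
  descendant_degree_sum T i (i + d%:Z) = (n - 3)%N.
Proof.
move=> nd; rewrite -(card_diagonals n_ge3 triT s) -descendant_degree_sumE.
  rewrite /descendant_degree_sum.
  rewrite (_ : absz _ = d.+1); last by lia.
  rewrite (_ : absz _ = n.-1.+1); last by lia.
  rewrite -!(big_mkord xpredT (fun m => descendant_degree T i (i + m%:Z))).
  rewrite (@big_cat_nat _ _ _ n.-1.+1 0 d.+1) /=; [|lia|lia].
  rewrite [X in (_ + X)%N]big_nat [X in (_ + X)%N]big1 ?addn0 // => x xn.
  by rewrite /descendant_degree ifF //; lia.
by lia.
Qed.

(** The two chosen solutions make w_0, w_1 the standard basis, of determinant 1. *)
Lemma nu_triE sigma d : is_frieze n (quiddity T) sigma -> (d <= n.+1)%N ->
  let c m := quiddity T m%:Z in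
  nu_tri sigma i (i + d%:Z)
  = ones (fun x y => det (linrec c 1 0) (linrec c 0 1) x y == 1) s (s + d).
Proof.
move=> hsigma dn c; rewrite /nu_tri (_ : absz _ = d); last by lia.
rewrite (card_ones (fun x y => sigma (i + x%:Z) (i + y%:Z) == 1)) ones_shift.
apply: eq_big_nat => y yd; apply: eq_big_nat => x xy.
rewrite (frieze_det n_ge3 (chord_noncrossing n_ge3 triT)
  (quiddity_degrees n_ge3 triT) (@chord_wrap n T n_ge3)
  (chord_full n_ge3 triT) (linrec_recurrence _ 1 0) (linrec_recurrence _ 0 1)
  _ hsigma quiddity_shift) //.
by lia.
Qed.

End BaseVertex.

Theorem proposition4p2 (n : nat) (hn : (3 <= n)%N) (T : {set {set 'Z_n}})
    (hT : is_triangulation T) (sigma : int -> int -> int)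
    (hsigma : is_frieze n (quiddity T) sigma)
    (i j : int) (hij : 0 <= j - i <= n%:Z + 1) :
  [/\ i <= j <= i + n%:Z - 2 ->
        nu_tri sigma i j = descendant_degree_sum T i j,
      j = i + n%:Z - 1 ->
        nu_tri sigma i j = (descendant_degree_sum T i (i + n%:Z - 1)%R + 1)%N /\
        (descendant_degree_sum T i (i + n%:Z - 1)%R + 1 = n - 2)%N,
      j = i + n%:Z ->
        nu_tri sigma i j
          = (descendant_degree_sum T i (i + n%:Z)%R + quiddity T i + 1)%N /\
        (descendant_degree_sum T i (i + n%:Z)%R + quiddity T i + 1
          = n - 2 + quiddity T i)%N
    & j = i + n%:Z + 1 ->
        nu_tri sigma i j
          = (descendant_degree_sum T i (i + n%:Z + 1)%R
             + quiddity T i + quiddity T (i + 1)%R + 1)%N /\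
        (descendant_degree_sum T i (i + n%:Z + 1)%R
             + quiddity T i + quiddity T (i + 1)%R + 1
          = n - 2 + quiddity T i + quiddity T (i + 1)%R)%N].
Proof.
have [s _ is_] := natZ_offset hn 0 (vertex n i); rewrite add0n in is_.
have nc := chord_noncrossing hn hT.
have full := chord_full hn hT.
have dg := quiddity_degrees hn hT.
have wr := @chord_wrap n T hn.
pose c m := quiddity T m%:Z.
have recf : recurrence c (linrec c 1 0) := linrec_recurrence c 1 0.
have recg : recurrence c (linrec c 0 1) := linrec_recurrence c 0 1.
have qi : quiddity T i = c s.
  by have := quiddity_shift T is_ 0; rewrite addr0 addn0.
have qi1 : quiddity T (i + 1) = c s.+1.
  by have := quiddity_shift T is_ 1; rewrite addn1.
have [d jE] : exists d : nat, j = i + d%:Z by exists `|j - i|%N; lia.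
have [e1 e3] : i + n%:Z - 1 = i + n.-1%:Z
    /\ i + n%:Z + 1 = i + n.+1%:Z by split; lia.
rewrite {}jE in hij *.
have nu := nu_triE hn hT is_ hsigma.
have l := descendant_degree_sum_full hn hT is_.
rewrite qi qi1 e1 e3; split.
- move=> dn; rewrite nu; last by lia.
  rewrite (descendant_degree_sumE T hn is_); last by lia.
  rewrite (ones_det hn nc dg wr full recf recg) //; last by lia.
  by rewrite ones_chord_sub //; lia.
- move=> dn; have -> : d = n.-1 by lia.
  rewrite nu ?l; [|lia..].
  rewrite (ones_det hn nc dg wr full recf recg) //; last by lia.
  (* The excess of n - 2 over the n - 3 diagonals is the edge v_i v_(i+n-1). *)
  by rewrite (ones_chord_full hn hT); lia.
- move=> dn; have -> : d = n by lia.
  rewrite nu ?l; [|lia..].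
  rewrite (ones_det_n hn nc dg wr full recf recg) //.
  by rewrite (ones_chord_full hn hT) -/(c s); lia.
- move=> dn; have -> : d = n.+1 by lia.
  rewrite nu ?l; [|lia..].
  rewrite addnS (ones_det_n1 hn nc dg wr full recf recg) //.
  by rewrite (ones_chord_full hn hT) -/(c s) -/(c s.+1); lia.
Qed.
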